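(* Let $f:\mathbb{N}\to\mathbb{N}_{\ge 1}$ be an arithmetic function such that $f(n)=o(\log\log n)$ as $n\to\infty$. Then for Lebesgue-almost every irrational $\alpha\in(0,1)$, \[ \lim_{n\to\infty} S(\alpha,n,f(n))^{1/f(n)} = \infty. \]
   Context: Every irrational $\alpha\in(0,1)$ has a unique continued fraction expansion $\alpha = 1/(a_1(\alpha)+1/(a_2(\alpha)+\cdots))$ with digits $a_i(\alpha)\in\mathbb{N}_{\ge1}$. For $1\le k\le n$ integers, the $k$-th elementary symmetric mean of the first $n$ digits is \[ S(\alpha,n,k) := \binom{n}{k}^{-1}\sum_{1\le i_1<\cdots<i_k\le n} a_{i_1}(\alpha)\cdots a_{i_k}(\alpha). \] Convention: if $k=k(n)$ is not an integer, $S(\alpha,n,k)^{1/k}$ means $S(\alpha,n,\lceil k\rceil)^{1/\lceil k\rceil}$. *)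

(* Defs.v *)
From HB Require Import structures.
From mathcomp Require Import all_boot all_order all_algebra.
From mathcomp Require Import all_classical all_reals all_analysis.
Set Implicit Arguments. Unset Strict Implicit. Unset Printing Implicit Defensive.
Import Order.TTheory GRing.Theory Num.Theory.
Local Open Scope ring_scope.

Section CF.
Variable R : realType.

Definition gauss (x : R) : R := x^-1 - (Num.floor (x^-1))%:~R.

Definition cf_digit (i : nat) (x : R) : nat :=
  Num.truncn ((iter i.-1 gauss x)^-1).

Definition S (x : R) (n k : nat) : R :=
  ('C(n, k)%:R)^-1 *
  \sum_(A : {set 'I_n} | #|A| == k) \prod_(i in A) (cf_digit (val i).+1 x)%:R.


End CF.

(* Main.v *)
(* Conditionally on the previous digits, a continued fraction digit is [>= t]
   with probability at least [1/t]: cylinders have length [1/(q (q + q'))], and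
   the next digit is [>= t] on a part of length [1/(q (t q + q'))]. Hence the
   number of digits [>= t] among the first [n] has exponential moment
   [E exp(- count) <= exp(- n/(2t))], so by Markov and Borel-Cantelli it is
   almost surely at least [n/(4t)] for all large [n]. Summing over [t <= T] and
   using the divergence of the harmonic series, the mean of the digits truncated
   at [T] eventually exceeds any given [2L] if [T] is large.
   On the other hand [(k+1) e_(k+1) >= e_k * (s - k T)], where [s] is the sum of
   the truncated digits: an index set of size [k] costs at most [k T]. As long
   as [k T <= L n] each step multiplies the symmetric mean by at least [L], so
   [S(x, n, k) >= L^k]. *)
Require Import Defs.
From HB Require Import structures.
From mathcomp Require Import all_boot all_order all_algebra.
From mathcomp Require Import all_classical all_reals all_analysis.
From mathcomp Require Import ring lra zify.
Set Implicit Arguments. Unset Strict Implicit. Unset Printing Implicit Defensive.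
Import Order.TTheory GRing.Theory Num.Theory.
Local Open Scope ring_scope.
Local Open Scope classical_set_scope.

(** * Continued fraction digits and the Gauss map *)

Definition unit_irrational {R : realType} : set R :=
  [set x | 0 < x < 1 /\ irrational x].

(** The shift starts at digit 1, since [cf_digit 0] coincides with [cf_digit 1]. *)
Lemma cf_digit_gauss (R : realType) (i : nat) (x : R) :
  cf_digit i.+1 (gauss x) = cf_digit i.+2 x.
Proof. by rewrite /cf_digit /= -iterSr. Qed.

Lemma floor_inv (R : realType) (x : R) : 0 < x < 1 ->
  (Num.floor x^-1)%:~R = (cf_digit 1 x)%:R :> R.
Proof.
move=> /andP[x0 x1]; rewrite /cf_digit /= truncn_floor invr_ge0 (ltW x0).
by rewrite natr_absz ger0_norm// floor_ge0 invr_ge0 ltW.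
Qed.

Lemma cf_digit1_gt0 (R : realType) (x : R) : 0 < x < 1 -> (0 < cf_digit 1 x)%N.
Proof.
move=> /andP[x0 x1]; rewrite /cf_digit /= truncn_gt0.
by rewrite invf_ge1// ltW.
Qed.

Lemma cf_digit1_gauss (R : realType) (x : R) : 0 < x < 1 ->
  x = ((cf_digit 1 x)%:R + gauss x)^-1.
Proof. by move=> x01; rewrite /gauss floor_inv// addrC subrK invrK. Qed.

Lemma gauss_unit_irrational (R : realType) (x : R) :
  unit_irrational x -> unit_irrational (gauss x).
Proof.
move=> [x01 xirr].
have girr : irrational (gauss x).
  move=> [r _ rE]; apply: xirr.
  exists ((r + (Num.floor x^-1)%:~R)^-1) => //.
  by rewrite fmorphV rmorphD/= ratr_int rE /gauss subrK invrK.
split=> //; rewrite /gauss.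
have /andP[h1 h2] := floor_itv x^-1.
rewrite intrD in h2.
apply/andP; split; last lra.
rewrite subr_gt0 lt_neqAle h1 andbT; apply/eqP => E; apply: girr.
by exists 0 => //; rewrite rmorph0 /gauss E subrr.
Qed.

Lemma cf_digit_gt0 (R : realType) (i : nat) (x : R) :
  unit_irrational x -> (0 < cf_digit i.+1 x)%N.
Proof.
elim: i x => [|i IH] x xI; first by apply: cf_digit1_gt0; case: xI.
by rewrite -cf_digit_gauss IH//; exact: gauss_unit_irrational.
Qed.

(** * Outer measure bounds *)

(** An outer measure bound witnessed by a measurable cover, so that no measurability of the digit
    sets has to be established. *)
Definition covered {R : realType} (A : set R) (r : R) : Prop :=
  exists U : set R, [/\ measurable U, A `<=` U &
    (@lebesgue_measure R U <= r%:E)%E].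

Lemma covered_bigcup (R : realType) (A : nat -> set R) (B : set R)
    (r : nat -> R) (s : R) :
  (forall k, covered (A k) (r k)) -> B `<=` \bigcup_k A k ->
  (forall n, \sum_(0 <= k < n) r k <= s) -> covered B s.
Proof.
move=> /choice[U UP] BA rs; exists (\bigcup_k U k); split.
- by apply: bigcup_measurable => k _; case: (UP k).
- by move=> x /BA[k _ Akx]; exists k => //; case: (UP k) => _ + _; apply.
- apply: le_trans (generalized_Boole_inequality _ _ _) _.
  + by move=> k; case: (UP k).
  + by apply: bigcup_measurable => k _; case: (UP k).
  apply: lime_le; first by apply: is_cvg_nneseries => k _ _; exact: measure_ge0.
  near=> n; apply: le_trans (_ : (\sum_(0 <= k < n) (r k)%:E <= _)%E).
    by apply: lee_sum => k _; case: (UP k).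
  by rewrite sumEFin lee_fin.
Unshelve. all: by end_near. Qed.

Lemma covered_le (R : realType) (A B : set R) (r s : R) :
  A `<=` B -> r <= s -> covered B r -> covered A s.
Proof.
move=> AB rs [U [mU BU Ur]]; exists U; split=> //.
  exact: subset_trans BU.
by apply: le_trans Ur _; rewrite lee_fin.
Qed.

Lemma covered_ball (R : realType) (c r : R) (A : set R) : 0 <= r ->
  (forall x, A x -> `|x - c| <= r) -> covered A (2 * r).
Proof.
move=> r0 Ac; exists (`[c - r, c + r]%classic); split.
- exact: measurable_itv.
- by move=> x /Ac; rewrite /= in_itv/= ler_distl.
- rewrite lebesgue_measure_itv/= lte_fin; case: ifPn => _.
    by rewrite -EFinD lee_fin; lra.
  by rewrite lee_fin; lra.
Qed.

Lemma covered_set0 (R : realType) (r : R) : 0 <= r -> covered (@set0 R) r.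
Proof. by move=> r0; exists set0; split=> //; rewrite measure0 lee_fin. Qed.

Lemma negligible_covered (R : realType) (A : set R) (r : nat -> R) :
  (forall k, covered A (r k)) -> r @ \oo --> 0 ->
  (@lebesgue_measure R).-negligible A.
Proof.
move=> /choice[U UP] r0; exists (\bigcap_k U k); split.
- by apply: bigcapT_measurable => k; case: (UP k).
- apply/eqP; rewrite eq_le measure_ge0 andbT.
  have : (EFin \o r) @ \oo --> 0%E by apply: cvg_EFin => //; exact: nearW.
  move/cvge_to_ge; apply; apply: nearW => k /=.
  have [mU _ h] := UP k.
  apply: le_trans h; apply: le_measure; rewrite ?inE//.
    by apply: bigcapT_measurable => j; case: (UP j).
  exact: bigcap_inf.
- by move=> x Ax k _; case: (UP k) => _ + _; apply.
Qed.

(** * Exponential moment of the number of large digits *)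

Definition large_digits {R : realType} (t n : nat) (x : R) : R :=
  \sum_(0 <= i < n) (t <= cf_digit i.+1 x)%N%:R.

Lemma large_digitsS (R : realType) (t n : nat) (x : R) :
  large_digits t n.+1 x =
  (t <= cf_digit 1 x)%N%:R + large_digits t n (gauss x).
Proof.
rewrite /large_digits big_nat_recl//; congr (_ + _).
by apply: eq_bigr => i _; rewrite cf_digit_gauss.
Qed.

(* Length of the image of [0, 1] under a Moebius map
   [y |-> (p + p' y) / (q + q' y)] of determinant 1 or -1. *)
Definition cyl_len {R : realType} (q q' : R) : R := (q * (q + q'))^-1.

Lemma cyl_len_ge0 (R : realType) (q q' : R) : 0 < q -> 0 <= q' ->
  0 <= cyl_len q q'.
Proof. by move=> q0 q'0; rewrite invr_ge0 mulr_ge0 ?addr_ge0// ltW. Qed.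

Lemma expRN1_le_half (R : realType) : expR (- 1) <= 2^-1 :> R.
Proof.
rewrite expRN lef_pV2 ?posrE ?expR_gt0//.
by have := @expR_ge1Dx R 1; lra.
Qed.

(** One digit contributes a factor e^(-1/(2t)) to the moment: digits [>= t] take a share of at least
    1/t, their weight is at most 1/2, and 1 - 1/(2t) <= e^(-1/(2t)). *)
Lemma cyl_len_sum_le (R : realType) (t M : nat) (q q' : R) : (0 < t)%N ->
  0 < q -> 0 <= q' <= q ->
  \sum_(0 <= k < M)
     cyl_len (k.+1%:R * q + q') q * expR (- (t <= k.+1)%N%:R) <=
  cyl_len q q' * expR (- (2 * t%:R)^-1).
Proof.
move=> t0 q0 /andP[q'0 q'q].
(* [d a] is the total length of the subcylinders with next digit [>= a], so single lengths
   telescope. *)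
pose d (a : nat) : R := (q * (a%:R * q + q'))^-1.
have den a : 0 < a.+1%:R * q + q'.
  by rewrite ltr_pwDl// mulr_gt0.
have dent : 0 < t%:R * q + q' by rewrite -(prednK t0).
have d0 a : 0 <= d a.
  have aq : 0 <= a%:R * q by rewrite mulr_ge0// ltW.
  by rewrite invr_ge0 mulr_ge0 ?addr_ge0// ltW.
have dS a : cyl_len (a.+1%:R * q + q') q = d a.+1 - d a.+2.
  rewrite /cyl_len /d; have := den a; have := den a.+1.
  rewrite -(natr1 a.+1) => h1 h2.
  by field; rewrite !gt_eqF//; lra.
(* [D a] bounds the weighted sum over all digits [>= a], the weight [e^-1] of a
   digit [>= t] being relaxed to [1/2]. *)
pose D a := d a - d (maxn a t) / 2.
have step k : cyl_len (k.+1%:R * q + q') q * expR (- (t <= k.+1)%N%:R) <=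
    D k.+1 - D k.+2.
  have c0 : 0 <= cyl_len (k.+1%:R * q + q') q by apply: cyl_len_ge0; [exact: den|exact: ltW].
  case: (leqP t k.+1) => [tk|kt] /=.
    rewrite /D (maxn_idPl tk) (maxn_idPl (leqW tk)).
    have := ler_wpM2l c0 (expRN1_le_half R); rewrite dS => h.
    by apply: le_trans h _; lra.
  by rewrite /D oppr0 expR0 mulr1 (maxn_idPr (ltnW kt)) (maxn_idPr kt) dS; lra.
apply: le_trans (ler_sum _ (fun k _ => step k)) _.
have -> : \sum_(0 <= k < M) (D k.+1 - D k.+2) = D 1%N - D M.+1.
  have := telescope_sumr (fun k => - D k.+1) (leq0n M).
  rewrite opprK addrC => <-; apply: eq_bigr => k _.
  by rewrite opprK addrC.
have DM : 0 <= D M.+1.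
  rewrite /D subr_ge0; case: (leqP M.+1 t) => [Mt|tM].
    suff : d t <= d M.+1 by have := d0 t; lra.
    rewrite /d lef_pV2 ?posrE; [|exact/mulr_gt0/dent|exact/mulr_gt0/den].
    by rewrite ler_pM2l// lerD2r ler_pM2r// ler_nat.
  by have := d0 M.+1; lra.
apply: (@le_trans _ _ (D 1%N)); first by lra.
rewrite /D (maxn_idPr t0).
have e := @expR_ge1Dx R (- (2 * t%:R)^-1).
apply: (le_trans _ (ler_wpM2l (cyl_len_ge0 q0 q'0) e)).
have -> : d 1%N = cyl_len q q' by rewrite /d mul1r.
suff : cyl_len q q' * t%:R^-1 <= d t.
  by rewrite mulrDr mulr1 lerD2l mulrN lerN2 invfM; lra.
rewrite /cyl_len -invfM /d lef_pV2 ?posrE; last 2 first.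
- by rewrite !mulr_gt0 ?ltr0n//; lra.
- exact/mulr_gt0/dent.
have t1 : (1 : R) <= t%:R by rewrite ler1n.
have := ler_wpM2r q'0 t1; rewrite mul1r => h.
rewrite -mulrA ler_pM2l// mulrDl [q * _]mulrC lerD2l [q' * _]mulrC.
exact: h.
Qed.

(* Induction on [n] through the first digit [a]: precomposing the Moebius map
   [y |-> (p + p' y) / (q + q' y)] with [y |-> 1 / (a + y)] gives the one with
   coefficients [p a + p', p, q a + q', q]. *)
Lemma covered_moebius (R : realType) (t n : nat) (p p' q q' s : R) :
  (0 < t)%N -> 0 < q -> 0 <= q' <= q -> `|p' * q - p * q'| = 1 ->
  covered [set (p + p' * y) / (q + q' * y) | y in
             [set y | unit_irrational y /\ large_digits t n y <= s]]
    (2 * (cyl_len q q' * expR (s - n%:R / (2 * t%:R)))).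
Proof.
move=> t0; elim: n p p' q q' s => [|n IH] p p' q q' s q0 /andP[q'0 q'q] det.
  (* The count is 0 here: for [s < 0] the set is empty, for [s >= 0] the exponential factor is at
     least 1. *)
  case: (ltP s 0) => s0.
    apply: (@covered_le _ _ set0 _ _ _ (lexx _)); last first.
      by apply: covered_set0; rewrite !mulr_ge0 ?cyl_len_ge0 ?expR_ge0.
    by move=> _ [y [_ h] <-]; move: h; rewrite /large_digits big_geq//; lra.
  apply: (@covered_le _ _ _ _ _ (@subset_refl _ _)); last first.
    (* The image of (0, 1) has endpoint [p / q] and length [cyl_len q q']; the ball centred there
       has twice that length, whence the factor 2. *)
    apply: (@covered_ball _ (p / q) (cyl_len q q')); first exact: cyl_len_ge0.
    move=> _ [y [[/andP[y0 y1] _] _] <-].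
    have qy : 0 < q + q' * y by rewrite ltr_pwDl// mulr_ge0// ltW.
    have -> : (p + p' * y) / (q + q' * y) - p / q =
        (p' * q - p * q') * (y / (q * (q + q' * y))).
      by field; rewrite !gt_eqF.
    rewrite normrM det mul1r ger0_norm; last first.
      by rewrite divr_ge0 ?mulr_ge0// ltW.
    rewrite /cyl_len invfM mulrCA invfM ler_pM2l ?invr_gt0//.
    rewrite ler_pdivrMr// mulrC ler_pdivlMr; last by lra.
    by nra.
  rewrite ler_pM2l// ler_peMr ?cyl_len_ge0//.
  by rewrite mul0r subr0 -expR0 ler_expR.
(* [u k] is the bound left for the remaining digits when the first one is [k.+1]. *)
pose u k : R := s - (t <= k.+1)%N%:R.
pose Q k : R := k.+1%:R * q + q'.
have Q0 k : 0 < Q k by rewrite ltr_pwDl// mulr_gt0.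
apply: (@covered_bigcup _
   (fun k => [set (k.+1%:R * p + p' + p * y) / (Q k + q * y) | y in
                [set y | unit_irrational y /\ large_digits t n y <= u k]]) _
   (fun k => 2 * (cyl_len (Q k) q * expR (u k - n%:R / (2 * t%:R))))).
- move=> k; apply: IH => //.
    rewrite ltW//= /Q -natr1; have : 0 <= k%:R * q by rewrite mulr_ge0// ltW.
    by lra.
  have -> : p * Q k - (k.+1%:R * p + p') * q = - (p' * q - p * q').
    by rewrite /Q; ring.
  by rewrite normrN.
- move=> _ [y [yI ys] <-].
  have gI := gauss_unit_irrational yI.
  have a0 := cf_digit_gt0 0 yI.
  have aE : ((cf_digit 1 y).-1.+1 = cf_digit 1 y)%N by rewrite prednK.
  exists (cf_digit 1 y).-1 => //; exists (gauss y).
    split=> //; rewrite /u aE; move: ys; rewrite large_digitsS; lra.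
  rewrite /Q aE.
  have yE := cf_digit1_gauss (proj1 yI).
  have [/andP[g0 g1] _] := gI.
  set g := gauss y in g0 g1 yE *.
  set a : R := (cf_digit 1 y)%:R in yE *.
  have a0' : 0 <= a by [].
  rewrite yE.
  have h1 : 0 < a + g by lra.
  have h2 : 0 < a * q + q' + q * g.
    have := mulr_ge0 a0' (ltW q0); have := mulr_gt0 q0 g0; lra.
  field; rewrite !gt_eqF//.
  lra.
- move=> M.
  rewrite -mulr_sumr ler_pM2l//.
  have -> : cyl_len q q' * expR (s - n.+1%:R / (2 * t%:R)) =
    (cyl_len q q' * expR (- (2 * t%:R)^-1)) * expR (s - n%:R / (2 * t%:R)).
    rewrite -mulrA -expRD -natr1; congr (_ * expR _).
    by rewrite mulrDl mul1r; ring.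
  apply: (le_trans _ (ler_wpM2r (expR_ge0 _) (cyl_len_sum_le M t0 q0 _))).
    rewrite mulr_suml ler_sum// => k _.
    rewrite -mulrA -expRD /u.
    rewrite (_ : s - _ - _ = - (t <= k.+1)%N%:R + (s - n%:R / (2 * t%:R)))//.
    by ring.
  by rewrite q'0.
Qed.

(** * Elementary symmetric sums *)

Lemma bin_succ_natr (R : realType) (n k : nat) : (k < n)%N ->
  k.+1%:R * 'C(n, k.+1)%:R = (n%:R - k%:R) * 'C(n, k)%:R :> R.
Proof. by move=> kn; rewrite -natrM mul_bin_left natrM natrB// ltnW. Qed.

Definition esym_sum {R : realType} {n : nat} (b : 'I_n -> R) (k : nat) : R :=
  \sum_(A : {set 'I_n} | #|A| == k) \prod_(i in A) b i.

(* Both sides sum [\prod_(i in B) b i] over the pairs [(B, i)] with [i] in [B],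
   [#|B| = k.+1]; on the right [A = B :\ i]. *)
Lemma esym_sum_succ (R : realType) (n k : nat) (b : 'I_n -> R) :
  k.+1%:R * esym_sum b k.+1 =
  \sum_(A : {set 'I_n} | #|A| == k)
    (\prod_(i in A) b i) * (\sum_(i | i \notin A) b i).
Proof.
rewrite /esym_sum mulr_sumr.
transitivity (\sum_(B : {set 'I_n} | #|B| == k.+1) \sum_(i in B)
    \prod_(j in B) b j).
  by apply: eq_bigr => B /eqP cB; rewrite sumr_const cB mulr_natl.
rewrite (exchange_big_dep predT)//=.
transitivity (\sum_(A : {set 'I_n} | #|A| == k)
    \sum_(i | i \notin A) (\prod_(j in A) b j) * b i); last first.
  by apply: eq_bigr => A _; rewrite mulr_sumr.
rewrite [RHS](exchange_big_dep predT)//=; apply: eq_bigr => i _.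
rewrite (reindex_onto (fun A => i |: A)%SET (fun B => B :\ i)%SET)/=; last first.
  by move=> B /andP[_ iB]; rewrite finset.setD1K.
apply: eq_big => [A|A /andP[/andP[cA _] /eqP AE]].
  rewrite finset.setU11 andbT cardsU1; case: (boolP (i \in A)) => iA /=.
    rewrite andbF; apply/negbTE/negP => /andP[_ /eqP AE].
    by move: iA; rewrite -AE !inE eqxx.
  by rewrite finset.setU1K// eqxx !andbT add1n eqSS.
have iA : i \notin A by rewrite -AE !inE eqxx.
by rewrite big_setU1//= mulrC.
Qed.

Lemma esym_sum_ge (R : realType) (n k : nat) (b : 'I_n -> R) (L : R) :
  (forall i, 0 <= b i) -> 0 <= L -> (k <= n)%N ->
  (forall A : {set 'I_n}, (#|A| < k)%N -> L * n%:R <= \sum_(i | i \notin A) b i) ->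
  L ^+ k * 'C(n, k)%:R <= esym_sum b k.
Proof.
move=> b0 L0; elim: k => [|k IH] kn bL.
  rewrite expr0 bin0 mul1r /esym_sum (bigD1 (finset.set0)) ?cards0//= big_set0.
  by rewrite lerDl sumr_ge0// => A _; exact: prodr_ge0.
rewrite -(@ler_pM2l _ k.+1%:R)// esym_sum_succ.
apply: (@le_trans _ _ (L * n%:R * esym_sum b k)); last first.
  rewrite /esym_sum mulr_sumr; apply: ler_sum => A /eqP cA.
  by rewrite mulrC ler_wpM2l ?prodr_ge0// bL// cA.
have := IH (ltnW kn) (fun A Ak => bL A (ltnW Ak)) => {}IH.
apply: (le_trans _ (ler_wpM2l (mulr_ge0 L0 (ler0n _ n)) IH)).
(* The binomial coefficient grows by the factor (n - k)/(k + 1), the symmetric sum by at least L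
   n/(k + 1). *)
rewrite mulrCA bin_succ_natr// exprS.
have : 0 <= L * L ^+ k * 'C(n, k)%:R * k%:R.
  by rewrite !mulr_ge0// exprn_ge0.
lra.
Qed.

(** * Truncated digits *)

(** Layer-cake formula; it reduces truncated sums to the counts [large_digits]. *)
Lemma natr_minn_sum (R : realType) (T a : nat) :
  (minn a T)%:R = \sum_(1 <= t < T.+1) (t <= a)%N%:R :> R.
Proof.
rewrite -natr_sum big_add1 /=; congr (_%:R).
elim: T => [|T IH]; first by rewrite minn0 big_geq.
by rewrite big_nat_recr//= -IH; case: (ltnP T a); lia.
Qed.

Lemma sum_notin_ge (R : realType) (n T : nat) (a : 'I_n -> nat)
    (A : {set 'I_n}) :
  \sum_i (minn (a i) T)%:R - #|A|%:R * T%:R <=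
  \sum_(i | i \notin A) (a i)%:R :> R.
Proof.
rewrite (bigID (mem A))/= addrC addrAC.
have h : \sum_(i in A) (minn (a i) T)%:R <= #|A|%:R * T%:R :> R.
  by rewrite -natrM -natr_sum ler_nat -sum_nat_const leq_sum// => i _;
    exact: geq_minr.
have : \sum_(i | i \notin A) (minn (a i) T)%:R <=
    \sum_(i | i \notin A) (a i)%:R :> R.
  by apply: ler_sum => i _; rewrite ler_nat geq_minl.
lra.
Qed.

Lemma harmonic_unbounded (R : realType) (L : R) :
  exists T : nat, L <= \sum_(1 <= t < T.+1) t%:R^-1.
Proof.
apply: contrapT => /forallNP h.
apply: (@dvg_harmonic R); apply: nondecreasing_is_cvgn.
  by apply: nondecreasing_series => k _ _; exact: harmonic_ge0.
exists L => _ [T _ <-].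
have := h T; rewrite big_add1 => /negP; rewrite -ltNge => /ltW; exact.
Qed.

(** * Frequency of large digits almost everywhere *)

(** The threshold n/(4t) gives back half of the exponent n/(2t) of [covered_moebius], which leaves
    geometric decay. *)
Lemma covered_few_large_digits (R : realType) (t n : nat) : (0 < t)%N ->
  covered [set x : R | unit_irrational x /\
             large_digits t n x <= n%:R / (4 * t%:R)]
    (2 * expR (- (4 * t%:R)^-1) ^+ n).
Proof.
move=> t0; have t0' : 0 < t%:R :> R by rewrite ltr0n.
have det : `|1 * 1 - 0 * 0 : R| = 1 by rewrite mulr1 mul0r subr0 normr1.
have h01 : 0 <= (0 : R) <= 1 by rewrite lexx ler01.
(* The identity is the Moebius map with [p = q' = 0] and [p' = q = 1]. *)
apply: covered_le (covered_moebius n (n%:R / (4 * t%:R)) t0 ltr01 h01 det).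
  by move=> x [xI xs]; exists x => //; rewrite add0r mul0r mul1r addr0 divr1.
rewrite /cyl_len addr0 mulr1 invr1 mul1r ler_pM2l// -expRM_natl ler_expR.
rewrite -subr_ge0 le_eqVlt; apply/orP; left; apply/eqP.
rewrite mulrN; field; exact: lt0r_neq0.
Qed.

Lemma negligible_few_large_digits (R : realType) (t : nat) : (0 < t)%N ->
  (@lebesgue_measure R).-negligible [set x : R | unit_irrational x /\
     ~ \forall n \near \oo, n%:R / (4 * t%:R) <= large_digits t n x].
Proof.
move=> t0; set z : R := expR (- (4 * t%:R)^-1).
have z0 : 0 < z by exact: expR_gt0.
have z1 : z < 1 by rewrite expR_lt1 oppr_lt0 invr_gt0 mulr_gt0// ltr0n.
(* Borel-Cantelli: the exceptional sets from [N] on have total size at most 2 z^N/(1 - z). *)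
apply: (@negligible_covered _ _ (geometric (2 * (1 - z)^-1) z)); last first.
  by apply: cvg_geometric; rewrite gtr0_norm.
move=> N; apply: (covered_bigcup
  (fun k => covered_few_large_digits R (N + k) t0)).
  move=> x [xI h]; apply: contrapT => hx.
  apply: h; exists N => // n /= Nn; rewrite leNgt; apply/negP => lt_n.
  by apply: hx; exists (n - N)%N => //; rewrite /= subnKC//; split=> //; exact: ltW.
move=> n; rewrite -/z /=.
have -> : \sum_(0 <= k < n) 2 * z ^+ (N + k) =
    series (geometric (2 * z ^+ N) z) n.
  by apply: eq_bigr => k _; rewrite exprD mulrA.
rewrite geometric_seriesE ?lt_eqF// /=.
rewrite -!mulrA ler_pM2l// [leRHS]mulrC ler_pM2l ?exprn_gt0//.
rewrite ler_piMl ?invr_ge0 ?subr_ge0 ?(ltW z1)//.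
by rewrite gerBl exprn_ge0// ltW.
Qed.

Lemma near_truncated_sum_ge (R : realType) (x L : R) :
  (forall t, (0 < t)%N ->
     \forall n \near \oo, n%:R / (4 * t%:R) <= large_digits t n x) ->
  exists T : nat, \forall n \near \oo,
    L * n%:R <= \sum_(i < n) (minn (cf_digit i.+1 x) T)%:R.
Proof.
move=> hx; have [T hT] := harmonic_unbounded (4 * L); exists T.
(* Only finitely many thresholds up to [T] occur, so their eventual bounds hold simultaneously. *)
have : \forall n \near \oo, forall t : 'I_T,
    n%:R / (4 * t.+1%:R) <= large_digits t.+1 n x.
  by apply: filter_forall => t; exact: hx.
apply: filterS => n hn.
under eq_bigr do rewrite natr_minn_sum.
rewrite exchange_big/=.
apply: (@le_trans _ _ (\sum_(1 <= t < T.+1) n%:R / (4 * t%:R))).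
  have -> : \sum_(1 <= t < T.+1) n%:R / (4 * t%:R) =
      n%:R / 4 * \sum_(1 <= t < T.+1) t%:R^-1 :> R.
    by rewrite mulr_sumr; apply: eq_bigr => t _; rewrite invfM mulrA.
  have := ler_wpM2l (ler0n R n) hT; lra.
apply: ler_sum_nat => -[|t]// /andP[_ tT].
by have := hn (Ordinal (tT : (t < T)%N)); rewrite /large_digits big_mkord.
Qed.

(** * Growth of [f] and the limit *)

(** Two applications of ln y < y; the linear form serves to bound k T by L n. *)
Lemma near_le_linear (R : realType) (f : nat -> nat) :
  (forall e : R, 0 < e ->
     \forall n \near \oo, (f n)%:R <= e * ln (ln (n%:R : R))) ->
  forall e : R, 0 < e -> \forall n \near \oo, (f n)%:R <= e * n%:R.
Proof.
move=> hf e e0; near=> n.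
have n1 : 1 < n%:R :> R by rewrite ltr1n; near: n; exact: nbhs_infty_gt.
apply: (@le_trans _ _ (e * ln (ln n%:R))); first by near: n; exact: hf.
have l0 := ln_gt0 n1.
rewrite ler_pM2l// (le_trans (ltW (ln_sublinear l0)))// ltW// ln_sublinear//.
lra.
Unshelve. all: by end_near. Qed.

Lemma symmetric_mean_ge (R : realType) (x L : R) (n k T : nat) :
  0 <= L -> (k <= n)%N -> k%:R * T%:R <= L * n%:R ->
  2 * L * n%:R <= \sum_(i < n) (minn (cf_digit i.+1 x) T)%:R ->
  L ^+ k <= S x n k.
Proof.
move=> L0 kn kT hL.
have C0 : 0 < 'C(n, k)%:R :> R by rewrite ltr0n bin_gt0.
rewrite /S -ler_pdivrMl ?invr_gt0// invrK mulrC.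
apply: (esym_sum_ge _ L0 kn) => // A Ak.
apply: le_trans (sum_notin_ge R T _ A).
(* Deleting [A] costs at most k T <= L n of the available 2 L n, so L n remains. *)
have : #|A|%:R * T%:R <= k%:R * T%:R :> R.
  by rewrite ler_wpM2r// ler_nat ltnW.
lra.
Qed.

Unset Implicit Arguments.

Theorem theorem1p1 (R : realType) (f : nat -> nat)
  (hf1 : forall n, (1 <= f n)%N)
  (hfo : forall e : R, 0 < e ->
     \forall n \near \oo, (f n)%:R <= e * ln (ln (n%:R : R))) :
  {ae (@lebesgue_measure R), forall x : R,
     0 < x < 1 -> irrational x ->
     (fun n : nat => S x n (f n) `^ ((f n)%:R^-1)) @ \oo --> +oo}.
Proof.
(* One null set per positive threshold; outside their countable union every threshold is
   controlled. *)
have := negligible_bigcup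
  (fun t => @negligible_few_large_digits R t.+1 (ltn0Sn t)).
apply: negligibleS => x hx; apply: contrapT => nx; apply: hx => x01 xirr.
have {}nx t : (0 < t)%N ->
    \forall n \near \oo, n%:R / (4 * t%:R) <= large_digits t n x.
  move=> t0; apply: contrapT => nt; apply: nx.
  by exists t.-1 => //=; rewrite prednK.
apply/cvgryPge => A.
(* The maximum ensures [1 <= L], hence n <= L n. *)
pose L := Num.max A 1.
have L1 : 1 <= L by rewrite le_max lexx orbT.
have [T hT] := near_truncated_sum_ge (2 * L) nx.
near=> n.
(* [T.+1] is positive even if [T = 0], and it also yields [f n <= n], so that the binomial
   coefficient in [S] is nonzero. *)
have fT : (f n)%:R <= T.+1%:R^-1 * n%:R :> R.
  by near: n; apply: near_le_linear => //; rewrite invr_gt0.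
have fT' : (f n)%:R * T.+1%:R <= n%:R :> R by rewrite mulrC -ler_pdivlMl.
have f0 : 0 < (f n)%:R :> R by rewrite ltr0n.
have fn : (f n <= n)%N.
  by rewrite -(ler_nat R) (le_trans _ fT')// ler_peMr ?ler1n// ltW.
have h : L ^+ f n <= S x n (f n).
  apply: (@symmetric_mean_ge _ _ _ _ _ T) => //; first by lra.
    have : n%:R <= L * n%:R :> R by rewrite ler_peMl.
    move: fT'; rewrite -natr1; lra.
  by near: n.
have L0 : 0 <= L by lra.
apply: (@le_trans _ _ L); first by rewrite le_max lexx.
have -> : L = (L ^+ f n) `^ (f n)%:R^-1.
  by rewrite -powR_mulrn// -powRrM divff ?gt_eqF// powRr1.
apply: ge0_ler_powR => //; rewrite ?nnegrE ?invr_ge0 ?exprn_ge0//.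
by rewrite (le_trans _ h)// exprn_ge0.
Unshelve. all: by end_near. Qed.
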